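(* Let $G$ be an $n$-vertex graph with $\alpha(G)=2$. Then $$\mathring{s}(G)=\binom{n-q+1}{2}+\binom{q+1}{2},$$ where $q$ is the maximum size of a matching in the complement of $G$.
   Context: All graphs are finite and simple. The slow-coloring game on a graph $G$ is played by Lister and Painter. On each round, Lister marks a nonempty subset $M$ of the uncolored vertices, scoring $|M|$ points; Painter then colors (with a new color) a subset of $M$ that is independent in $G$. The game ends when all vertices are colored. Painter wants to minimize the total score and Lister wants to maximize it. The sum-color cost $\mathring{s}(G)$ is the total score under optimal play by both players (the score that each player can guarantee doing no worse than). $\alpha(G)$ is the maximum size of an independent set in $G$. A matching is a set of pairwise disjoint edges. *)

(* Defs.v *)
From HB Require Import structures.
From mathcomp Require Import all_boot.

Set Implicit Arguments.
Unset Strict Implicit.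
Unset Printing Implicit Defensive.

Record sgraph := SGraph {
  vertex :> finType;
  adj : rel vertex;
  adj_sym : symmetric adj;
  adj_irr : irreflexive adj
}.

Definition compl_adj (G : sgraph) : rel G :=
  fun x y => (x != y) && ~~ adj x y.

Lemma compl_adj_sym (G : sgraph) : symmetric (@compl_adj G).
Proof. by move=> x y; rewrite /compl_adj eq_sym adj_sym. Qed.

Lemma compl_adj_irr (G : sgraph) : irreflexive (@compl_adj G).
Proof. by move=> x; rewrite /compl_adj eqxx. Qed.

Definition complement (G : sgraph) : sgraph :=
  SGraph (@compl_adj_sym G) (@compl_adj_irr G).

Definition independent (G : sgraph) (A : {set G}) : bool :=
  [forall x in A, forall y in A, ~~ adj x y].

Definition alpha (G : sgraph) : nat :=
  \max_(A : {set G} | independent A) #|A|.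

Definition edges (G : sgraph) : {set {set G}} :=
  [set A : {set G} | [exists x, exists y, adj x y && (A == [set x; y])]].

Definition matching (G : sgraph) (P : {set {set G}}) : bool :=
  (P \subset edges G) && trivIset P.

Definition matching_number (G : sgraph) : nat :=
  \max_(P : {set {set G}} | matching P) #|P|.

(* A position of the slow-coloring game is the set [U] of uncolored vertices,
   and [k] is the total still to be scored. Painter may color the empty set, so
   plays can be infinite, with infinite score; since every round scores at
   least 1, a finite bound is always settled after finitely many rounds, which
   is why inductive predicates suffice. *)

(* From [U], Painter can make sure that the game ends with Lister scoring at
   most [k]; [f] gives Painter's reply to each marked set of the round. *)
Inductive painter_guarantees (G : sgraph) : {set G} -> nat -> Prop :=
| painter_end k : painter_guarantees set0 k
| painter_round (U : {set G}) k (f : {set G} -> {set G}) :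
    (forall M : {set G}, M != set0 -> M \subset U ->
       [/\ f M \subset M, independent (f M) & #|M| <= k]) ->
    (forall M : {set G}, M != set0 -> M \subset U ->
       painter_guarantees (U :\: f M) (k - #|M|)) ->
    painter_guarantees U k.

(* From [U], Lister can make sure to score at least [k]. The subtraction is
   truncated on purpose: once the target is reached, [0] remains to be scored. *)
Inductive lister_guarantees (G : sgraph) : {set G} -> nat -> Prop :=
| lister_end (U : {set G}) : lister_guarantees U 0
| lister_round (U : {set G}) k (M : {set G}) :
    M != set0 -> M \subset U ->
    (forall C : {set G}, C \subset M -> independent C ->
       lister_guarantees (U :\: C) (k - #|M|)) ->
    lister_guarantees U k.

(* [s] is the sum-color cost of [G]; it is unique by [sum_color_cost_unique]. *)
Definition is_sum_color_cost (G : sgraph) (s : nat) : Prop :=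
  painter_guarantees [set: G] s /\ lister_guarantees [set: G] s.

Lemma lister_le_painter (G : sgraph) (U : {set G}) (l p : nat) :
  lister_guarantees U l -> painter_guarantees U p -> l <= p.
Proof.
move=> hl; elim: hl p => {U l} [//|U l M M0 MU _ IH] p hp.
case: hp M0 MU IH => {U p} [k|{}U k f hf hU] M0' MU IH.
  by move: M0'; rewrite -subset0 MU.
have [fM indf Mk] := hf M M0' MU.
have := IH _ fM indf _ (hU M M0' MU).
by rewrite leq_subLR (subnKC Mk).
Qed.

Lemma sum_color_cost_unique (G : sgraph) (s t : nat) :
  is_sum_color_cost G s -> is_sum_color_cost G t -> s = t.
Proof.
case=> ps ls [pt lt]; apply/eqP.
by rewrite eqn_leq (lister_le_painter ls pt) (lister_le_painter lt ps).
Qed.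

(* Main.v *)
Require Import Defs.
From mathcomp Require Import all_boot.
From mathcomp Require Import zify.

(** Since independent sets have at most two vertices, Painter colors nothing,
    one vertex, or one edge of the complement H of G in each round.  Let U be
    the set of uncolored vertices.  Both players measure U by the potential
      [cost a b = 'C(a + 1, 2) + 'C(b + 1, 2)]   with   [a + b = #|U|],
    where b is the size, or a bound on the size, of a matching of H inside U.
    A round in which something is colored removes from (a, b) either one unit
    of a, lowering the potential by a, or one unit of b, lowering it by b, or
    both, lowering it by [a + b = #|U|].

    Painter maintains a matching P of H inside U, with [b = #|P|], and makes the
    potential drop by at least the number of marked vertices
    ([painter_reply]).  If the marked set M contains an edge of P, coloring it
    yields a drop of [#|U|].  Otherwise M has at most one vertex on each
    edge of P.  If M has a vertex outside [cover P], there are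
    [#|U| - 2 * #|P| + #|P| = a] marked vertices at most, and coloring such a
    vertex keeps P and yields a.  Finally, if M lies inside [cover P], it has
    at most b vertices, and coloring any of them costs one edge of P and
    yields b.

    Lister marks every uncolored vertex in each round.  He maintains an upper
    bound b on the matchings of H inside U, with [b <= a], and whatever Painter
    colors, a new such pair exists whose potential is lower by at most [#|U|]
    ([lister_invariant]): coloring an edge of H lowers the bound by one, because
    that edge would extend any remaining matching.

    Starting from b equal to the matching number of H, both players guarantee
    the same value [cost (n - q) q]. *)

(** * The potential *)

Definition cost (a b : nat) : nat := 'C(a + 1, 2) + 'C(b + 1, 2).

Lemma costC (a b : nat) : cost a b = cost b a.
Proof. exact: addnC. Qed.

Lemma cost_predl {a b : nat} : 0 < a -> cost a b = cost a.-1 b + a.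
Proof. by case: a => // a _; rewrite /cost !addn1 (binS a.+1 1) bin1 /=; lia. Qed.

Lemma cost_predr {a b : nat} : 0 < b -> cost a b = cost a b.-1 + b.
Proof. by rewrite costC => /cost_predl->; rewrite costC. Qed.

Lemma cost_pred {a b : nat} :
  0 < a -> 0 < b -> cost a b = cost a.-1 b.-1 + (a + b).
Proof. by move=> /cost_predl-> /cost_predr->; rewrite -addnA (addnC b). Qed.

(** * Matchings in the complement *)

Lemma independent1 {G : sgraph} (x : G) : independent [set x].
Proof.
by apply/forall_inP=> y /set1P->; apply/forall_inP=> z /set1P->; rewrite adj_irr.
Qed.

Definition nonedges (G : sgraph) : {set {set G}} :=
  [set C : {set G} | independent C && (#|C| == 2)].

Lemma edges_complement (G : sgraph) : edges (complement G) = nonedges G.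
Proof.
apply/setP=> C; rewrite [RHS]inE; apply/idP/andP=> [Ce | [indC]].
  move: Ce; rewrite inE => /existsP[x /existsP[y /andP[/andP[nxy xy] /eqP->]]].
  split; last by rewrite cards2 nxy.
  apply/forall_inP=> u /set2P[] ->; apply/forall_inP=> v /set2P[] ->;
    by rewrite ?adj_irr // adj_sym.
case/cards2P=> x [y [nxy eC]]; rewrite eC in indC *.
rewrite inE; apply/existsP; exists x; apply/existsP; exists y.
rewrite eqxx andbT /= /compl_adj nxy.
exact: forall_inP (forall_inP indC x (set21 x y)) y (set22 x y).
Qed.

(** These are the matchings of [complement G], but as families of subsets of [G]
    rather than of [complement G]: the two vertex types are convertible without
    being syntactically equal, and the game only mentions the first. *)
Definition comatching {G : sgraph} (P : {set {set G}}) : bool :=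
  (P \subset nonedges G) && trivIset P.

Lemma matching_number_complement (G : sgraph) :
  matching_number (complement G) = \max_(P : {set {set G}} | comatching P) #|P|.
Proof. by apply: eq_bigl => P; rewrite /matching edges_complement. Qed.

Lemma card_nonedge {G : sgraph} {C : {set G}} : C \in nonedges G -> #|C| = 2.
Proof. by rewrite inE => /andP[_ /eqP]. Qed.

Lemma card_rem_block {T : finType} {P : {set {set T}}} {E : {set T}} :
  E \in P -> #|P| = #|P :\ E|.+1.
Proof. by move=> EP; rewrite (cardsD1 E) EP. Qed.

Lemma comatching0 (G : sgraph) : @comatching G set0.
Proof. by rewrite /comatching sub0set; apply/trivIsetP=> ? ?; rewrite inE. Qed.

Lemma comatchingS {G : sgraph} {P Q : {set {set G}}} :
  P \subset Q -> comatching Q -> comatching P.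
Proof.
move=> PQ /andP[Qe Qt]; apply/andP.
by split; [exact: subset_trans PQ Qe | exact: trivIsetS PQ Qt].
Qed.

Lemma card_cover_comatching {G : sgraph} {P : {set {set G}}} :
  comatching P -> #|cover P| = #|P| * 2.
Proof.
case/andP=> /subsetP Pe /eqP <-; rewrite -sum_nat_const.
by apply: eq_bigr => E /Pe/card_nonedge.
Qed.

Lemma comatchingU1 {G : sgraph} {E : {set G}} {P : {set {set G}}} :
  E \in nonedges G -> comatching P -> [disjoint E & cover P] ->
  comatching (E |: P) /\ E \notin P.
Proof.
move=> Ee /andP[Pe Pt] dEP.
have dE B : B \in P -> [disjoint E & B].
  by move=> BP; apply: disjointWr dEP; exact: bigcup_sup.
have n0 : set0 \notin P.
  by apply/negP => /(subsetP Pe)/card_nonedge; rewrite cards0.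
have [tEP nEP] := trivIsetU1 dE Pt n0; split=> //.
by rewrite /comatching tEP subUset sub1set Ee Pe.
Qed.

(** Two marked vertices on the same edge of [P] would be the whole edge, so
    sending a marked vertex to its edge is injective. *)
Lemma card_setI_cover_comatching {G : sgraph} {P : {set {set G}}} {M : {set G}} :
  comatching P -> (forall E, E \in P -> ~~ (E \subset M)) ->
  #|M :&: cover P| <= #|P|.
Proof.
case/andP=> Pe Pt noE.
have inj : {in M :&: cover P &, injective (pblock P)}.
  move=> x y /setIP[xM xP] /setIP[yM yP] exy; apply/eqP.
  apply: contraT => nxy; have EP := pblock_mem xP.
  have /negP[] := noE _ EP.
  have /eqP <- : [set x; y] == pblock P x.
    rewrite eqEcard subUset !sub1set mem_pblock xP exy mem_pblock yP.
    by rewrite -exy (card_nonedge (subsetP Pe _ EP)) cards2 nxy.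
  by rewrite subUset !sub1set xM.
rewrite -(card_in_imset inj); apply: subset_leq_card.
by apply/subsetP=> _ /imsetP[x /setIP[_ xP] ->]; exact: pblock_mem.
Qed.

(** * Painter's strategy *)

(** Replies may be chosen separately for each marked set: there are finitely many
    of them, so a strategy function exists constructively. *)
Lemma painter_round_exists {G : sgraph} {U : {set G}} {k : nat} :
  (forall M : {set G}, M != set0 -> M \subset U ->
     exists C : {set G}, [/\ C \subset M, independent C, #|M| <= k
                 & painter_guarantees (U :\: C) (k - #|M|)]) ->
  painter_guarantees U k.
Proof.
move=> reply.
have /fin_all_exists[f fP] (M : {set G}) : exists C : {set G},
    M != set0 -> M \subset U ->
    [/\ C \subset M, independent C, #|M| <= k
      & painter_guarantees (U :\: C) (k - #|M|)].
  have [M0|] := boolP (M != set0); last by exists set0.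
  have [MU|] := boolP (M \subset U); last by exists set0.
  by have [C ?] := reply M M0 MU; exists C.
by apply: (@painter_round _ _ _ f) => M M0 MU; case: (fP M M0 MU).
Qed.

(** One round of Painter's strategy: the potential absorbs the [#|M|] points
    just scored.  Here [C] is an edge of [P] inside [M] if there is one, otherwise a
    vertex of [M] outside [cover P] if possible, otherwise any vertex of [M]. *)
Lemma painter_reply {G : sgraph} {U M : {set G}} {a : nat}
    {P : {set {set G}}} :
  M != set0 -> M \subset U -> comatching P -> cover P \subset U ->
  #|U| = a + #|P| ->
  exists (C : {set G}) (a' : nat) (P' : {set {set G}}),
    [/\ C \subset M /\ independent C, comatching P', cover P' \subset U :\: C,
        #|U :\: C| = a' + #|P'| & cost a' #|P'| + #|M| <= cost a #|P|].
Proof.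
move=> M0 MU mP PU cU.
have [Pe Pt] := andP mP.
have cP := card_cover_comatching mP.
have leaP : #|P| <= a.
  by have := subset_leq_card PU; rewrite cP cU muln2 -addnn leq_add2r.
have [[E [EP EM]] | noE] : (exists E : {set G}, E \in P /\ E \subset M) \/
    forall E : {set G}, E \in P -> ~~ (E \subset M).
  have [/exists_inP[E EP EM] | /exists_inPn] := boolP [exists E in P, E \subset M].
    by left; exists E.
  by right.
(* An edge of [P] is entirely marked: the drop is [a + #|P| = #|U|]. *)
- have := subsetP Pe _ EP; rewrite inE => /andP[indE /eqP cE].
  have cPE := card_rem_block EP.
  have a_gt0 : 0 < a by apply: leq_trans leaP; rewrite cPE.
  exists E, a.-1, (P :\ E); split=> //.
  - exact: comatchingS (subD1set _ _) mP.
  - by rewrite (coverD1 Pt EP) setSD.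
  - rewrite cardsD (setIidPr (subset_trans EM MU)) cE cU cPE.
    by rewrite addnS -{1}(prednK a_gt0) addSn !subSS subn0.
  have leM : #|M| <= a + #|P| by rewrite -cU subset_leq_card.
  by rewrite cPE in leM *; rewrite (cost_pred a_gt0 (ltn0Sn _)) leq_add2l.
have leMP := card_setI_cover_comatching mP noE.
have cM := cardsID (cover P) M.
(* A marked vertex lies outside [cover P]: [P] survives and the drop is [a]. *)
have [/eqP MP0 | /set0Pn[x /setDP[xM xP]]] := eqVneq (M :\: cover P) set0; last first.
  have cUx := cardsD1 x U; rewrite (subsetP MU _ xM) add1n cU in cUx.
  have leMU : #|M :\: cover P| <= #|U :\: cover P|.
    by apply: subset_leq_card; exact: setSD.
  have {}leMU : #|M :\: cover P| <= a - #|P|.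
    rewrite (leq_trans leMU) // cardsD (setIidPr PU) cP cU.
    by rewrite muln2 -addnn subnDr.
  have leM : #|M| <= a by rewrite -cM -(subnKC leaP) leq_add.
  have a_gt0 : 0 < a by apply: leq_trans leM; rewrite card_gt0.
  exists [set x], a.-1, P; split=> //.
  - by rewrite sub1set xM independent1.
  - by rewrite subsetD1 PU.
  - by apply: succn_inj; rewrite -cUx -addSn prednK.
  by rewrite (cost_predl a_gt0) leq_add2l.
(* All marked vertices lie on distinct edges of [P]: the drop is [#|P|]. *)
rewrite setD_eq0 in MP0.
have /set0Pn[x xM] := M0.
have xP : x \in cover P := subsetP MP0 _ xM.
have cUx := cardsD1 x U; rewrite (subsetP MU _ xM) add1n cU in cUx.
have EP := pblock_mem xP; set E := pblock P x in EP.
have cPE := card_rem_block EP.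
exists [set x], a, (P :\ E); split=> //.
- by rewrite sub1set xM independent1.
- exact: comatchingS (subD1set _ _) mP.
- by rewrite (coverD1 Pt EP) setDSS // sub1set mem_pblock.
- by apply: succn_inj; rewrite -cUx cPE addnS.
rewrite (setIidPl MP0) in leMP.
by rewrite cPE in leMP *; rewrite (cost_predr (ltn0Sn _)) leq_add2l.
Qed.

(** The induction is on [k], the points Lister may still score, which each round
    lowers by [#|M| > 0] even when few vertices get colored. *)
Lemma painter_guarantees_cost {G : sgraph} {U : {set G}} {a k : nat}
    {P : {set {set G}}} :
  comatching P -> cover P \subset U -> #|U| = a + #|P| -> cost a #|P| <= k ->
  painter_guarantees U k.
Proof.
elim/ltn_ind: k U a P => k IH U a P mP PU cU lek.
apply: painter_round_exists => M M0 MU.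
have [C [a' [P' [[CM indC] mP' PU' cU' ineq]]]] := painter_reply M0 MU mP PU cU.
have M_gt0 : 0 < #|M| by rewrite card_gt0.
have leMk : #|M| <= k := leq_trans (leq_addl _ _) (leq_trans ineq lek).
exists C; split=> //; apply: (IH _ _ _ a' P') => //.
  by rewrite ltn_subrL M_gt0 (leq_trans M_gt0).
by rewrite leq_subRL // addnC (leq_trans ineq).
Qed.

(** * Lister's strategy *)

(** When all of [U] is marked, no reply [C] of Painter lowers the potential by more
    than the [#|U|] points scored.  The bound [b] need not stay sharp, but
    [b <= a] must persist: a bound exceeding half of [#|U|] could make the
    potential larger than what Lister can score.  So if a single vertex is
    colored while [a = b], it is [b] that decreases, as [2b - 1] vertices carry
    at most [b - 1] disjoint edges. *)
Lemma lister_invariant {G : sgraph} {U C : {set G}} {a b : nat} :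
  #|C| <= 2 -> C \subset U -> independent C -> #|U| = a + b -> b <= a ->
  (forall P : {set {set G}},
     comatching P -> cover P \subset U -> #|P| <= b) ->
  exists a' b', [/\ #|U :\: C| = a' + b', b' <= a',
     forall P : {set {set G}},
       comatching P -> cover P \subset U :\: C -> #|P| <= b'
   & cost a b <= cost a' b' + #|U|].
Proof.
move=> C2 CU indC cU leba maxb.
have cD := cardsD U C; rewrite (setIidPr CU) in cD.
have leC := subset_leq_card CU.
have maxb' P : comatching P -> cover P \subset U :\: C -> #|P| <= b.
  by move=> mP PU; apply: maxb => //; apply: subset_trans PU (subsetDl _ _).
have [C_eq2 | C_neq2] := eqVneq #|C| 2.
  have Ce : C \in nonedges G by rewrite inE indC C_eq2.
  (* [C] extends every matching that avoids it. *)
  have maxC P : comatching P -> cover P \subset U :\: C -> #|P| < b.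
    move=> mP; rewrite subsetD disjoint_sym => /andP[PU dCP].
    have [mCP nCP] := comatchingU1 Ce mP dCP.
    have := maxb _ mCP; rewrite cardsU1 nCP; apply.
    by rewrite /cover bigcup_setU big_set1 subUset CU.
  have b_gt0 : 0 < b.
    apply: leq_ltn_trans (leq0n _) (maxC set0 (comatching0 G) _).
    by rewrite /cover big_set0 sub0set.
  exists a.-1, b.-1; split; try lia.
    by move=> P mP PU; have := maxC P mP PU; lia.
  by rewrite cost_pred ?cU //; lia.
have [C_eq0 | C_neq0] := eqVneq #|C| 0.
  by exists a, b; split=> //; lia.
have [ltba | leab] := ltnP b a.
  exists a.-1, b; split=> //; try lia.
  by rewrite cost_predl ?cU ?leq_add2l ?leq_addr //; lia.
exists a, b.-1; split; try lia.
  move=> P mP PU; have := subset_leq_card PU.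
  by rewrite (card_cover_comatching mP); lia.
by rewrite cost_predr ?cU ?leq_add2l ?leq_addl //; lia.
Qed.

(** The induction is again on [k], because Painter may color nothing and leave
    [U] unchanged. *)
Lemma lister_guarantees_cost {G : sgraph} {U : {set G}} {a b k : nat} :
  alpha G <= 2 -> #|U| = a + b -> b <= a ->
  (forall P : {set {set G}},
     comatching P -> cover P \subset U -> #|P| <= b) ->
  k <= cost a b -> lister_guarantees U k.
Proof.
move=> al2; elim/ltn_ind: k U a b => k IH U a b cU leba maxb lek.
have [->|k_gt0] := posnP k; first exact: lister_end.
have U_gt0 : 0 < #|U|.
  rewrite lt0n; apply: contraTneq lek => U0.
  have [-> ->] : a = 0 /\ b = 0 by lia.
  by rewrite -ltnNge.
apply: (@lister_round _ _ _ U); rewrite -?card_gt0 // => C CU indC.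
have C2 : #|C| <= 2.
  by apply: leq_trans al2; exact: (leq_bigmax_cond (F := fun A => #|pred_of_set A|)).
have [a' [b' [cU' leba' maxb' ineq]]] := lister_invariant C2 CU indC cU leba maxb.
by apply: (IH _ _ _ a' b') => //; lia.
Qed.

(** * The sum-color cost *)

Theorem theorem1p6 (G : sgraph) (n q : nat) :
  #|G| = n ->
  alpha G = 2 ->
  q = matching_number (complement G) ->
  is_sum_color_cost G ('C(n - q + 1, 2) + 'C(q + 1, 2)).
Proof.
rewrite matching_number_complement => cG al2 qE.
have maxq (P : {set {set G}}) : comatching P -> #|P| <= q.
  move=> mP; rewrite qE.
  exact: (leq_bigmax_cond (F := fun A : {set {set G}} => #|A|)).
have [P mP Pq] : exists2 P : {set {set G}}, comatching P & #|P| = q.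
  rewrite qE; have [|P mP ->] := @eq_bigmax_cond _ (@comatching G) (fun P => #|P|).
    by apply/card_gt0P; exists set0; exact: comatching0.
  by exists P.
have q2n : q * 2 <= n.
  by rewrite -Pq -(card_cover_comatching mP) -cG; exact: max_card.
have cU : #|[set: G]| = n - q + q by rewrite cardsT cG; lia.
split.
  by apply: (@painter_guarantees_cost _ _ (n - q) _ P); rewrite ?subsetT ?Pq.
apply: (@lister_guarantees_cost _ _ (n - q) q) => //; rewrite ?al2 //; first by lia.
by move=> Q mQ _; exact: maxq.
Qed.
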